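(* Let $(X,\|\cdot\|)$ be a normed vector space over $\mathbb{R}$ of dimension $d<\infty$. Fix $\lambda\ge 1$ and fix $\tau$ with $1<\tau\le 2$. If $\{S_i:1\le i\le n\}$ is an ordered collection of subsets of $X$ in $\tau$-satellite configuration with respect to an ordered set $\{\mathbf{a}_i:1\le i\le n\}\subset X$, and if $S_i\in\mathcal{S}_\lambda(\mathbf{a}_i)$ for $1\le i\le n$, then $$n\le N(64\lambda^{3})+N(8\lambda^{2})\,N_S(16\lambda).$$
   Context: $B(\mathbf{a},r)=\{\mathbf{x}\in X:\|\mathbf{x}-\mathbf{a}\|\le r\}$ is the closed ball; $\Delta(S)$ denotes the diameter of a set $S$ and $\operatorname{int}(S)$ its interior. $\tau$-satellite configuration: fix $\tau>1$. Let $\{S_i:1\le i\le n\}$ be an ordered collection of subsets of $X$ with each $S_i$ having finite diameter and containing a point $a_i$ in its interior. The ordered collection of sets $S_i$ is in $\tau$-satellite configuration with respect to the ordered set of points $a_i$ if (i) for all $i\le n$, $S_i\cap S_n\ne\varnothing$, and (ii) for all pairs $i<j\le n$, $a_j\notin\operatorname{int}(S_i)$ and $\Delta(S_j)<\tau\cdot\Delta(S_i)$. For $\lambda\ge1$ and $\mathbf{a}\in X$, $\mathcal{S}_\lambda(\mathbf{a})$ denotes the collection of all sets $S\subseteq X$ for which there exists $r>0$ such that $B(\mathbf{a},r)\subseteq S\subseteq B(\mathbf{a},\lambda r)$ and $S$ is starlike with respect to every $\mathbf{y}\in B(\mathbf{a},r)$, i.e. for each $\mathbf{y}\in B(\mathbf{a},r)$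 and each $\mathbf{x}\in S$ the segment $\{\alpha\mathbf{y}+(1-\alpha)\mathbf{x}:0\le\alpha\le1\}$ is contained in $S$. For each $\gamma\ge1$, $N(\gamma)$ is an upper bound for the number of points that can be packed into the closed ball $B(\mathbf{0},1)$ when the distance between distinct points is at least $1/\gamma$ and one point is at $\mathbf{0}$; $N_S(\gamma)$ is the similar constant (upper bound for the number of points with pairwise distances at least $1/\gamma$) when all points are on the surface $\{\|\mathbf{x}\|=1\}$ of $B(\mathbf{0},1)$. *)

(* Defs.v *)
From mathcomp Require Import all_boot all_order all_algebra.
From mathcomp Require Import all_classical all_reals all_analysis.

Set Implicit Arguments.
Unset Strict Implicit.
Unset Printing Implicit Defensive.

Import Order.TTheory GRing.Theory Num.Theory.
Import numFieldNormedType.Exports.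

Local Open Scope classical_set_scope.
Local Open Scope ring_scope.

Section Besicovitch.
Context {R : realType} {X : normedModType R}.
Implicit Types (S : set X) (a x y : X).

Definition cball a (r : R) : set X := [set x | `|x - a| <= r].

(* The extended-real supremum makes the diameter of an unbounded set +oo;
   the diameter of the empty set is -oo. *)
Definition diam S : \bar R :=
  ereal_sup [set `|p.1 - p.2|%:E | p in S `*` S].

(* Indices are 0-based: the last set of the collection is the one whose index k
   satisfies k.+1 = n. *)
Definition satellite_configuration (tau : R) (n : nat)
    (S : 'I_n -> set X) (a : 'I_n -> X) : Prop :=
  [/\ (forall i, (diam (S i) < +oo)%E /\ (S i)° (a i)),
      (forall i k : 'I_n, k.+1 = n -> S i `&` S k !=set0) &
      (forall i j : 'I_n, (i < j)%N ->
         ~ (S i)° (a j) /\ (diam (S j) < tau%:E * diam (S i))%E)].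

Definition segment y x : set X :=
  [set alpha *: y + (1 - alpha) *: x | alpha in [set t : R | 0 <= t <= 1]].

Definition starlike_wrt S y : Prop := forall x, S x -> segment y x `<=` S.

Definition starlike_class (lambda : R) a : set (set X) :=
  [set S | exists r : R, [/\ 0 < r,
     cball a r `<=` S, S `<=` cball a (lambda * r) &
     forall y, cball a r y -> starlike_wrt S y]].

Definition dist_separated (delta : R) (k : nat) (p : 'I_k -> X) : Prop :=
  forall i j : 'I_k, i != j -> delta <= `|p i - p j|.

End Besicovitch.

(* For delta > 0 a delta-separated family is injective, so k is the number of
   points packed. *)
Definition packing_bound {R : realType} (X : normedModType R)
    (gamma : R) (m : nat) : Prop :=
  forall (k : nat) (p : 'I_k -> X),
    (forall i, cball 0 1 (p i)) -> (exists i, p i = 0) ->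
    dist_separated (1 / gamma) p -> (k <= m)%N.

Definition sphere_packing_bound {R : realType} (X : normedModType R)
    (gamma : R) (m : nat) : Prop :=
  forall (k : nat) (p : 'I_k -> X),
    (forall i, `|p i| = 1) ->
    dist_separated (1 / gamma) p -> (k <= m)%N.

(* Main.v *)
(* Put [b i = a i - a n], with inner radii [r i].  For [i < j] one has
   [r i <= |a j - a i|], and comparing diameters gives [r j <= 2 lambda (r i)].
   The near indices, [|b i| <= 32 lambda^2 (r n)], are then counted by one
   packing.  For the far indices, [S i] contains the hull of the ball around
   [a i] and a point of [S i] close to [a n]; if [b j] points almost in the
   direction of [b i] and is not longer, [a j] is interior to this hull, so
   [i < j] is impossible.  Hence among far indices of nearly equal direction
   [|b i|] increases with [i], all [r i] are at least [max |b| / (8 lambda^2)],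
   and, with [a n] at the origin, a packing bounds their number.  The number of
   such direction clusters is bounded by a packing on the sphere. *)
Require Import Defs.
From mathcomp Require Import all_boot all_order all_algebra.
From mathcomp Require Import lra.
From mathcomp Require Import all_classical all_reals all_analysis.

Set Implicit Arguments.
Unset Strict Implicit.
Unset Printing Implicit Defensive.

Import Order.TTheory GRing.Theory Num.Theory.
Import numFieldNormedType.Exports.

Local Open Scope ring_scope.

(** * Packing bounds for finite index sets, balls of any radius, and clusters *)

Section Packing.
Context {R : realType} {X : normedModType R}.

Lemma packing_bound_card (gamma rho : R) (m : nat) (T : finType) (A : {set T})
    (f : T -> X) :
  packing_bound X gamma m -> 0 < rho ->
  (forall i, i \in A -> `|f i| <= rho) -> (exists2 i, i \in A & f i = 0) ->
  {in A &, forall i j, i != j -> rho / gamma <= `|f i - f j|} ->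
  (#|A| <= m)%N.
Proof.
move=> hm rho0 hle [i0 i0A fi0] hsep.
apply: (hm _ (fun k : 'I_#|A| => rho^-1 *: f (enum_val k))).
- move=> k; rewrite /cball /= subr0 normrZ gtr0_norm ?invr_gt0 //.
  by rewrite mulrC ler_pdivrMr // mul1r hle // enum_valP.
- by exists (enum_rank_in i0A i0); rewrite enum_rankK_in // fi0 scaler0.
- move=> k l kl; rewrite -scalerBr normrZ gtr0_norm ?invr_gt0 //.
  rewrite ler_pdivlMl // mul1r.
  by apply: hsep; rewrite ?enum_valP // (inj_eq enum_val_inj).
Qed.

Lemma sphere_packing_bound_card (gamma : R) (m : nat) (T : finType)
    (A : {set T}) (u : T -> X) :
  sphere_packing_bound X gamma m -> (forall i, i \in A -> `|u i| = 1) ->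
  {in A &, forall i j, i != j -> 1 / gamma <= `|u i - u j|} ->
  (#|A| <= m)%N.
Proof.
move=> hm u1 hsep; apply: (hm _ (fun k : 'I_#|A| => u (enum_val k))).
- by move=> k; rewrite u1 // enum_valP.
- by move=> k l kl; apply: hsep; rewrite ?enum_valP // (inj_eq enum_val_inj).
Qed.

(** Choose a maximal [delta]-separated [A] inside [F]. A point of [F] at distance at least [delta]
    from all of [A] could be added to it, so the clusters around the points of [A] cover [F]. *)
Lemma leq_card_clusters (T : finType) (F : {set T}) (u : T -> X) (delta : R)
    (m k : nat) : 0 < delta ->
  (forall A : {set T}, A \subset F ->
     {in A &, forall i j, i != j -> delta <= `|u i - u j|} -> (#|A| <= m)%N) ->
  (forall c, c \in F ->
     (#|[set i in F | (`|u i - u c| < delta)%R]| <= k)%N) ->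
  (#|F| <= k * m)%N.
Proof.
move=> delta0 hm hk.
pose sep (A : {set T}) := (A \subset F) &&
  [forall i in A, forall j in A, (i != j) ==> (delta <= `|u i - u j|)].
have sepP A : sep A -> {in A &, forall i j, i != j -> delta <= `|u i - u j|}.
  by move=> /andP[_ /forall_inP h] i j iA jA; apply/implyP/(forall_inP (h _ iA)).
have [A /maxsetP[sA maxA] _] : {A : {set T} | maxset sep A & finset.set0 \subset A}.
  apply: maxset_exists; rewrite /sep finset.sub0set.
  by apply/forall_inP => i; rewrite inE.
have AF : A \subset F by case/andP: sA.
have cover : F \subset (\bigcup_(c in A) [set i in F | (`|u i - u c| < delta)%R])%SET.
  apply/fintype.subsetP => i iF; apply: contraT => ni.
  have far c : c \in A -> delta <= `|u i - u c|.
    move=> cA; rewrite leNgt; apply: contra ni => lt.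
    by apply/finset.bigcupP; exists c; rewrite // inE iF.
  have iA : i \notin A.
    by apply/negP => /far; rewrite subrr normr0 leNgt delta0.
  suff /maxA/(_ (finset.subsetUr _ _))/setP/(_ i) : sep (i |: A)%SET.
    by rewrite !inE eqxx (negPf iA).
  rewrite /sep finset.subUset finset.sub1set iF AF /=.
  apply/forall_inP => p /setU1P[->|pA]; apply/forall_inP => q /setU1P[->|qA];
    apply/implyP => pq.
  - by rewrite eqxx in pq.
  - exact: far.
  - by rewrite distrC far.
  - exact: (sepP _ sA).
apply: leq_trans (subset_leq_card cover) _.
apply: (@leq_trans (\sum_(c in A) k)).
  elim/big_rec2: _ => [|c x B /(fintype.subsetP AF) /hk hc hB]; first by rewrite cards0.
  by apply: leq_trans (leq_card_setU _ _) _; rewrite leq_add.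
by rewrite sum_nat_const mulnC leq_mul2l hm ?orbT //; apply: sepP.
Qed.

End Packing.

Local Open Scope classical_set_scope.

(** * Interior points and diameters of starlike sets *)

Section Starlike.
Context {R : realType} {X : normedModType R}.
Implicit Types (S : set X) (a v x y z : X).

(** Contracting the ball around [a] towards [x] by the factor [t] gives the ball of radius [t * r]
    around [t *: a + (1 - t) *: x], and starlikeness keeps this image inside [S]. *)
Lemma starlike_ball_interior S a x z (r t : R) :
  (forall y, cball a r y -> starlike_wrt S y) -> S x -> 0 < t <= 1 ->
  `|z - (t *: a + (1 - t) *: x)| < t * r -> S° z.
Proof.
move=> star Sx /andP[t0 t1] hz; set c := t *: a + (1 - t) *: x in hz.
suff sub : ball c (t * r) `<=` S.
  rewrite /interior; apply: filterS sub _; apply: open_nbhs_nbhs; split.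
    exact: ball_open.
  by rewrite -ball_normE /ball_ /= distrC.
move=> w; rewrite -ball_normE /ball_ /= distrC => hw.
have tn0 : t != 0 by rewrite gt_eqF.
(* The preimage of [w] under the contraction. *)
apply: (star (a + t^-1 *: (w - c)) _ x Sx).
  rewrite /cball /= addrAC subrr add0r normrZ gtr0_norm ?invr_gt0 //.
  by rewrite mulrC ler_pdivrMr // mulrC ltW.
exists t; first by rewrite /= ltW.
by rewrite scalerDr scalerA divff // scale1r addrAC addrC subrK.
Qed.

Definition direction v : X := `|v|^-1 *: v.

Lemma norm_direction v : v != 0 -> `|direction v| = 1.
Proof.
by move=> v0; rewrite normrZ ger0_norm ?invr_ge0 // mulVf // normr_eq0.
Qed.

(** Seen from [y], the point of the segment from [x] to [a] with weight [t] on [a], where [t] is the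
    ratio of the lengths of [z - y] and [a - y], misses [z] for two reasons only: the angle between
    the directions, and the offset [x - y] damped by [1 - t]. *)
Lemma starlike_direction_interior S a x y z (r : R) :
  (forall w, cball a r w -> starlike_wrt S w) -> S x ->
  z != y -> `|z - y| <= `|a - y| ->
  `|x - y| + `|z - y| * `|direction (z - y) - direction (a - y)|
    < `|z - y| / `|a - y| * r ->
  S° z.
Proof.
move=> star Sx zy za lt; set t := `|z - y| / `|a - y|.
have z0 : 0 < `|z - y| by rewrite normr_gt0 subr_eq0.
have a0 : 0 < `|a - y| by apply: lt_le_trans za.
have t0 : 0 < t by rewrite divr_gt0.
have t1 : t <= 1 by rewrite ler_pdivrMr // mul1r.
apply: (starlike_ball_interior star Sx (t := t)); first by rewrite t0.
apply: le_lt_trans lt.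
have -> : z - (t *: a + (1 - t) *: x) =
    `|z - y| *: (direction (z - y) - direction (a - y)) - (1 - t) *: (x - y).
  rewrite scalerBr /direction !scalerA divff ?gt_eqF // scale1r -/t.
  rewrite -[in LHS](subrK y z) -[in LHS](subrK y a) -[in LHS](subrK y x).
  rewrite !scalerDr addrACA -scalerDl subrKC scale1r opprD addrACA subrr addr0.
  by rewrite opprD addrA.
apply: le_trans (ler_normB _ _) _.
rewrite normrZ normr_id addrC lerD2r normrZ ger0_norm ?subr_ge0 //.
by rewrite ler_piMl // gerBl ltW.
Qed.

Lemma le_diam S x y : S x -> S y -> (`|x - y|%:E <= diam S)%E.
Proof. by move=> Sx Sy; apply: ereal_sup_ubound; exists (x, y). Qed.

Lemma diam_le_cball S a (r : R) :
  S `<=` cball a r -> (diam S <= (2 * r)%:E)%E.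
Proof.
move=> sub; apply: ge_ereal_sup => _ [[x y] /= [/sub hx /sub hy] <-].
rewrite lee_fin mulr_natl mulr2n -(subrKA a x).
by apply: le_trans (ler_normD _ _) _; rewrite lerD // distrC.
Qed.

(** The ends of a diameter along [v] realise [2 * r]; [v] excludes the zero space, where every ball
    has diameter 0. *)
Lemma cball_le_diam S a v (r : R) :
  v != 0 -> 0 < r -> cball a r `<=` S -> ((2 * r)%:E <= diam S)%E.
Proof.
move=> v0 r0 sub; pose w := r *: direction v.
have nw : `|w| = r by rewrite normrZ norm_direction // mulr1 gtr0_norm.
have -> : 2 * r = `|(a + w) - (a - w)|.
  by rewrite opprD opprK addrACA subrr add0r -mulr2n normrMn nw mulr_natl.
apply: le_diam; apply: sub; rewrite /cball /= addrAC subrr add0r ?normrN nw //.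
Qed.

Lemma notin_interior_dist S a x (r : R) :
  cball a r `<=` S -> ~ S° x -> r <= `|x - a|.
Proof.
move=> sub nx; rewrite leNgt; apply/negP => lt; apply: nx.
rewrite /interior; apply: (@filterS _ _ _ (ball a r)).
  by move=> y; rewrite -ball_normE /ball_ /= distrC => h; apply: sub; apply: ltW.
by apply: open_nbhs_nbhs; split; [exact: ball_open|rewrite -ball_normE /ball_ /= distrC].
Qed.

End Starlike.

(** * Counting the near and the far centres *)

Theorem theorem6 (R : realType) (X : normedModType R) (d : nat)
    (dimX : Vector.axiom d X)
    (N N_S : R -> nat)
    (hN : forall gamma : R, 1 <= gamma -> packing_bound X gamma (N gamma))
    (hN_S : forall gamma : R, 1 <= gamma ->
       sphere_packing_bound X gamma (N_S gamma))
    (lambda tau : R) (hlambda : 1 <= lambda) (htau : 1 < tau <= 2)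
    (n : nat) (S : 'I_n -> set X) (a : 'I_n -> X)
    (hsat : satellite_configuration tau S a)
    (hS : forall i : 'I_n, starlike_class lambda (a i) (S i)) :
  (n <= N (64 * lambda ^+ 3)%R
        + N (8 * lambda ^+ 2)%R * N_S (16 * lambda)%R)%N.
Proof.
case: n S a hsat hS => [//|m] S a [hfin touch hord] hS.
have [r hr] := choice hS.
have r0 i : 0 < r i by case: (hr i).
have sub i : cball (a i) (r i) `<=` S i by case: (hr i).
have sup i : S i `<=` cball (a i) (lambda * r i) by case: (hr i).
have star i y : cball (a i) (r i) y -> starlike_wrt (S i) y.
  by case: (hr i) => _ _ _; apply.
have l0 : 0 < lambda by apply: lt_le_trans hlambda.
pose o : 'I_m.+1 := ord_max.
pose b i := a i - a o.
have lt_o i : i != o -> (i < o)%N.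
  by move=> io; rewrite ltn_neqAle -ltnS ltn_ord andbT; apply: contra_neq io => /val_inj.
have sep (i j : 'I_m.+1) : (i < j)%N -> r i <= `|b i - b j|.
  move=> /hord[ni _]; rewrite /b opprB subrKA distrC.
  exact: notin_interior_dist ni.
have ratio (i j : 'I_m.+1) : (i < j)%N -> r j <= 2 * lambda * r i.
  move=> ij; have [_ lt] := hord i j ij.
  have nz : b i - b j != 0.
    by rewrite -normr_gt0; apply: lt_le_trans (sep _ _ ij).
  have := cball_le_diam nz (r0 j) (sub j).
  have lei := diam_le_cball (sup i).
  have tau0 : 0 < tau by lra.
  move=> /le_lt_trans/(_ lt)/lt_le_trans.
  move=> /(_ (tau * (2 * (lambda * r i)))%:E).
  rewrite EFinM lee_pmul2l // => /(_ lei); rewrite -EFinM lte_fin => h.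
  (* Here [tau <= 2] enters. *)
  have : tau * (lambda * r i) <= 2 * (lambda * r i).
    by rewrite ler_wpM2r ?mulr_ge0 ?(ltW l0) ?(ltW (r0 _)) //; case/andP: htau.
  lra.
have touch' i : exists2 x, S i x & `|x - a o| <= lambda * r o.
  by have [x [Sx /sup]] := touch i o erefl; exists x.
have b_le i : `|b i| <= lambda * r i + lambda * r o.
  have [x /sup xi xo] := touch' i.
  rewrite /b -(subrKA x) (le_trans (ler_normD _ _)) // lerD // distrC //.
pose F := [set i | 32 * lambda ^+ 2 * r o < `|b i|]%SET.
have bo : b o = 0 by rewrite /b subrr.
(* [sep] uses the radius of the smaller index of a pair, which is never [o]; hence no lower bound on
   [r o] is required. *)
have sepA (delta : R) (A : {set 'I_m.+1}) :
    (forall i, i \in A -> i != o -> delta <= r i) ->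
    {in A &, forall i j, i != j -> delta <= `|b i - b j|}.
  move=> hdelta i j iA jA ij.
  wlog lt : i j iA jA ij / (i < j)%N.
    move=> wl; case: (ltngtP i j) => [|lt|/val_inj eq]; first exact: wl.
      by rewrite distrC wl // eq_sym.
    by rewrite eq eqxx in ij.
  apply: le_trans (sep _ _ lt); apply: hdelta => //.
  apply: contraTneq lt => ->; rewrite -leqNgt; exact: leq_ord.
have near : (#|~: F| <= N (64 * lambda ^+ 3)%R)%N.
  apply: (@packing_bound_card _ _ (64 * lambda ^+ 3) (32 * lambda ^+ 2 * r o)
    _ _ _ b).
  - apply: hN; nra.
  - by rewrite !mulr_gt0 ?exprn_gt0.
  - by move=> i; rewrite !inE -leNgt.
  - exists o => //.
    by rewrite !inE bo normr0 -leNgt !mulr_ge0 ?exprn_ge0 ?ltW.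
  (* The required separation is [r o / (2 * lambda)], which is [ratio] with [o] as the later
     index. *)
  apply: sepA => i _ /lt_o /ratio h.
  rewrite ler_pdivrMr ?mulr_gt0 ?exprn_gt0 //.
  have : 32 * lambda ^+ 2 * r o <= 32 * lambda ^+ 2 * (2 * lambda * r i).
    by rewrite ler_wpM2l // mulr_ge0 ?exprn_ge0 ?ltW.
  by rewrite !exprS expr0; lra.
have bF i : i \in F -> lambda * r o < `|b i| / (32 * lambda).
  by rewrite inE ltr_pdivlMr ?mulr_gt0 //; apply: le_lt_trans; rewrite expr2; lra.
have bF0 i : i \in F -> 0 < `|b i|.
  by rewrite inE; apply: le_lt_trans; rewrite !mulr_ge0 ?exprn_ge0 ?ltW.
have b_far i : i \in F -> `|b i| * 31 <= 32 * lambda * r i.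
  move=> iF; have := bF i iF; have := b_le i.
  (* By [bF], the term [lambda * r o] in [b_le] is at most 1/32 of the norm of [b i], which leaves
     31/32 for [lambda * r i]. *)
  suff : `|b i| / (32 * lambda) <= `|b i| / 32 by lra.
  rewrite ler_wpM2l // lef_pV2 ?posrE ?mulr_gt0 //.
  lra.
pose u i := direction (b i).
have far : (#|F| <= N (8 * lambda ^+ 2)%R * N_S (16 * lambda)%R)%N.
  apply: (@leq_card_clusters _ _ _ _ u (1 / (16 * lambda))).
  - by rewrite divr_gt0 ?mulr_gt0.
  - move=> A /fintype.subsetP AF; apply: sphere_packing_bound_card.
      by apply: hN_S; lra.
    by move=> i /AF /bF0; rewrite normr_gt0; apply: norm_direction.
  move=> c cF; set C := [set i in F | _]%SET.
  have CP i : i \in C -> i \in F /\ `|u i - u c| < 1 / (16 * lambda).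
    by rewrite inE => /andP.
  have mono (i j : 'I_m.+1) : i \in C -> j \in C -> (i < j)%N -> `|b i| < `|b j|.
    move=> /CP[iF ic] /CP[jF jc] ij; rewrite ltNge; apply/negP => le.
    case: (hord i j ij) => + _; apply.
    have [x Sx hx] := touch' i.
    have bj := bF0 j jF; have bi := bF0 i iF.
    (* In units of the norm of [b j] over [lambda]: the offset of [x] costs less than 1/32 ([h1]),
       the directions, both close to [u c], at most 4/32 ([h2]), and at least 31/32 is available
       ([h3]). *)
    apply: (starlike_direction_interior (star i) Sx (y := a o)) => //.
      by rewrite -subr_eq0 -normr_gt0.
    rewrite -/(b i) -/(b j) -/(u i) -/(u j).
    have uij : `|u j - u i| <= 2 / (16 * lambda).
      rewrite -(subrKA (u c)) (le_trans (ler_normD _ _)) // (distrC (u c)).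
      lra.
    have h1 := bF j jF.
    have h2 : `|b j| * `|u j - u i| <= `|b j| * (2 / (16 * lambda)).
      by rewrite ler_wpM2l.
    have h3 : `|b j| * (31 / (32 * lambda)) <= `|b j| / `|b i| * r i.
      rewrite -[leRHS]mulrA ler_wpM2l // ler_pdivlMl // mulrA.
      by rewrite ler_pdivrMr ?mulr_gt0 // [leRHS]mulrC b_far.
    have h4 : 0 < `|b j| / lambda by rewrite divr_gt0.
    rewrite !invfM in h1 h2 h3; lra.
  have [->|[i0 i0C]] := set_0Vmem C; first by rewrite cards0.
  have [l lC lmax] : exists2 l, l \in C & forall i, i \in C -> `|b i| <= `|b l|.
    by case: (arg_maxP (fun i => `|b i|) i0C) => l lC h; exists l.
  have [lF _] := CP l lC.
  (* Adding [o] supplies the point at the origin that [packing_bound] demands. *)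
  apply: (@leq_trans #|o |: C|); first exact: subset_leq_card (finset.subsetUr _ _).
  apply: (@packing_bound_card _ _ (8 * lambda ^+ 2) `|b l| _ _ _ b).
  - apply: hN; nra.
  - exact: bF0.
  - by move=> i /setU1P[->|/lmax //]; rewrite bo normr0.
  - by exists o; rewrite // setU11.
  apply: sepA => i /setU1P[->|iC _]; first by rewrite eqxx.
  rewrite ler_pdivrMr ?mulr_gt0 ?exprn_gt0 //.
  have bl := b_far l lF.
  (* For [i < l], [b_far] and [ratio] bound 31 times the norm of [b l] by [64 * lambda ^+ 2 * r i],
     and 64/31 is below 8. An index after [l] would have a longer vector by [mono]. *)
  have [il|li|/val_inj il] := ltngtP i l.
  - have := ler_wpM2l (ltW l0) (ratio i l il).
    have : 0 <= lambda ^+ 2 * r i by rewrite mulr_ge0 ?exprn_ge0 ?ltW.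
    rewrite expr2; lra.
  - by have := mono l i lC iC li; rewrite ltNge lmax.
  - rewrite il; have : lambda * r l <= lambda ^+ 2 * r l.
      by rewrite ler_wpM2r ?(ltW (r0 _)) // expr2 ler_peMl ?(ltW l0).
    have : 0 < lambda * r l by rewrite mulr_gt0.
    lra.
by rewrite -[m.+1]card_ord -(cardsC F) addnC leq_add.
Qed.
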